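(* Let $k$ be a commutative ring, $G$ a finite group, and $V$ a $kG$-module that is free of finite rank as a $k$-module. Let $\mathbf{C}$ be one of the categories $\mathbf{Cpx}(kG)$, $\mathbf{Cpx}^+(kG)$, $\mathbf{Cpx}^-(kG)$ or $\mathbf{Cpx}^b(kG)$. Then $\mathbf{C}$ is idempotent complete, and so are the homotopy categories $\mathcal{K}(\mathbf{C})$, $\mathcal{K}_{V\text{-split}}(\mathbf{C})$, $\mathcal{K}_{V\text{-ts}}(\mathbf{C})$ and $\mathcal{K}_{\mathrm{ts}+V\text{-split}}(\mathbf{C})$.
   Context: $\mathbf{Cpx}(kG)$ is the category of cochain complexes of (arbitrary) $kG$-modules and chain maps; $\mathbf{Cpx}^+,\mathbf{Cpx}^-,\mathbf{Cpx}^b$ are the full subcategories of complexes bounded above, bounded below, and both. $\otimes=\otimes_k$ with diagonal $G$-action. An exact sequence $E$ of complexes is term split if in each degree it is a split sequence of $kG$-modules; $V$-split if $V\otimes E$ is split as a sequence of complexes; $V$-term split if $V\otimes E$ is term split; term+$V$-split if it is both term split and $V$-split. For a class $\mathscr{E}$ of exact sequences in $\mathbf{C}$, an object $P$ is $\mathscr{E}$-projective if $\mathrm{Hom}(P,-)$ sends each sequence in $\mathscr{E}$ to an exact sequence. $\mathbf{C}/\mathscr{E}\text{-}\mathbf{Proj}$ has the objects of $\mathbf{C}$ and the morphisms of $\mathbf{C}$ modulo those factoring through an $\mathscr{E}$-projective object. $\mathcal{K}(\mathbf{C})$ (the usual homotopy category), $\mathcal{K}_{V\text{-split}}(\mathbf{C})$,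 $\mathcal{K}_{V\text{-ts}}(\mathbf{C})$, $\mathcal{K}_{\mathrm{ts}+V\text{-split}}(\mathbf{C})$ denote this quotient for $\mathscr{E}$ the class of term split, $V$-split, $V$-term split, term+$V$-split sequences in $\mathbf{C}$, respectively. A category is idempotent complete if every idempotent $e:X\to X$ splits, i.e. $X=X'\oplus X''$ with $e$ the identity on $X'$ and zero on $X''$. *)

(* Defs.v *)
From HB Require Import structures.
From mathcomp Require Import all_boot all_order all_algebra all_fingroup.
From mathcomp Require Import generic_quotient ring_quotient boolp.

Set Implicit Arguments.
Unset Strict Implicit.
Unset Printing Implicit Defensive.

Import GRing.Theory.
Local Open Scope ring_scope.
Local Open Scope quotient_scope.

Record preadditive_category := PreadditiveCategory {
  obj :> Type;
  hom : obj -> obj -> zmodType;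
  idm : forall X, hom X X;
  mcomp : forall X Y Z, hom Y Z -> hom X Y -> hom X Z;
  mcompA : forall X Y Z T (h : hom Z T) (g : hom Y Z) (f : hom X Y),
    mcomp h (mcomp g f) = mcomp (mcomp h g) f;
  mcomp1m : forall X Y (f : hom X Y), mcomp (idm Y) f = f;
  mcompm1 : forall X Y (f : hom X Y), mcomp f (idm X) = f;
  mcompDl : forall X Y Z (g g' : hom Y Z) (f : hom X Y),
    mcomp (g + g') f = mcomp g f + mcomp g' f;
  mcompDr : forall X Y Z (g : hom Y Z) (f f' : hom X Y),
    mcomp g (f + f') = mcomp g f + mcomp g f'
}.

Notation "g '\co' f" := (mcomp g f)
  (at level 40, left associativity) : ring_scope.

Section Preadditive.
Variable A : preadditive_category.
Implicit Types X Y Z S : A.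

Lemma mcompm0 X Y Z (g : hom Y Z) : g \co (0 : hom X Y) = 0.
Proof.
have := mcompDr g (0 : hom X Y) 0; rewrite addr0 => /eqP.
by rewrite -subr_eq0 opprD addrA subrr sub0r oppr_eq0 => /eqP.
Qed.

Lemma mcomp0m X Y Z (f : hom X Y) : (0 : hom Y Z) \co f = 0.
Proof.
have := mcompDl (0 : hom Y Z) 0 f; rewrite addr0 => /eqP.
by rewrite -subr_eq0 opprD addrA subrr sub0r oppr_eq0 => /eqP.
Qed.

Lemma mcompmN X Y Z (g : hom Y Z) (f : hom X Y) : g \co (- f) = - (g \co f).
Proof. by apply/eqP; rewrite -addr_eq0 -mcompDr addNr mcompm0. Qed.

Lemma mcompNm X Y Z (g : hom Y Z) (f : hom X Y) : (- g) \co f = - (g \co f).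
Proof. by apply/eqP; rewrite -addr_eq0 -mcompDl addNr mcomp0m. Qed.

Definition is_zero_object X := idm X = 0.

Definition is_biproduct X Y S (i1 : hom X S) (i2 : hom Y S)
    (p1 : hom S X) (p2 : hom S Y) :=
  [/\ p1 \co i1 = idm X, p2 \co i2 = idm Y, p1 \co i2 = 0, p2 \co i1 = 0
    & i1 \co p1 + i2 \co p2 = idm S].

(** The sequence [X --f--> Y --g--> Z] is split; this entails [g \co f = 0]
    and [r \co s = 0], so that [Y] is the biproduct of [X] and [Z]. *)
Definition split_sequence X Y Z (f : hom X Y) (g : hom Y Z) :=
  exists (r : hom Y X) (s : hom Z Y),
    [/\ r \co f = idm X, g \co s = idm Z & f \co r + s \co g = idm Y].

Definition idempotent_splits X (e : hom X X) :=
  exists (X' X'' : A) (i' : hom X' X) (i'' : hom X'' X)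
         (p' : hom X X') (p'' : hom X X''),
    [/\ is_biproduct i' i'' p' p'', e \co i' = i' & e \co i'' = 0].

End Preadditive.

Record additive_category := AdditiveCategory {
  additive_base :> preadditive_category;
  zero_object_exists : exists Z : additive_base, is_zero_object Z;
  biproduct_exists : forall X Y : additive_base,
    exists (S : additive_base) (i1 : hom X S) (i2 : hom Y S)
      (p1 : hom S X) (p2 : hom S Y), is_biproduct i1 i2 p1 p2
}.

Definition idempotent_complete (A : additive_category) :=
  forall (X : A) (e : hom X X), e \co e = e -> idempotent_splits e.

Section FullSubcategory.
Variables (A : additive_category) (P : A -> Prop).
Hypothesis P_zero : forall Z : A, is_zero_object Z -> P Z.
Hypothesis P_biproduct : forall (X Y S : A) (i1 : hom X S) (i2 : hom Y S)
  (p1 : hom S X) (p2 : hom S Y),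
  is_biproduct i1 i2 p1 p2 -> P X -> P Y -> P S.

Record full_obj := FullObj { full_val :> A; full_valP : P full_val }.

Definition full_subcategory_base : preadditive_category :=
  @PreadditiveCategory full_obj (fun X Y : full_obj => hom (X : A) (Y : A))
    (fun X => idm (X : A)) (fun X Y Z g f => g \co f)
    (fun X Y Z T => @mcompA A X Y Z T) (fun X Y => @mcomp1m A X Y)
    (fun X Y => @mcompm1 A X Y) (fun X Y Z => @mcompDl A X Y Z)
    (fun X Y Z => @mcompDr A X Y Z).

Lemma full_zero : exists Z : full_subcategory_base, is_zero_object Z.
Proof. by have [Z Z0] := zero_object_exists A; exists (FullObj (P_zero Z0)). Qed.

Lemma full_biproduct (X Y : full_subcategory_base) :
  exists (S : full_subcategory_base) (i1 : hom X S) (i2 : hom Y S)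
    (p1 : hom S X) (p2 : hom S Y), is_biproduct i1 i2 p1 p2.
Proof.
have [S [i1 [i2 [p1 [p2 b]]]]] := biproduct_exists (X : A) (Y : A).
by exists (FullObj (P_biproduct b (full_valP X) (full_valP Y))), i1, i2, p1, p2.
Qed.

Definition full_subcategory : additive_category :=
  AdditiveCategory full_zero full_biproduct.

End FullSubcategory.

Record ideal (A : additive_category) := Ideal {
  in_ideal : forall X Y : A, hom X Y -> Prop;
  ideal0 : forall X Y : A, in_ideal (0 : hom X Y);
  idealB : forall (X Y : A) (f g : hom X Y),
    in_ideal f -> in_ideal g -> in_ideal (f - g);
  idealMl : forall (X Y Z : A) (g : hom Y Z) (f : hom X Y),
    in_ideal f -> in_ideal (g \co f);
  idealMr : forall (X Y Z : A) (g : hom Y Z) (f : hom X Y),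
    in_ideal g -> in_ideal (g \co f)
}.

Arguments in_ideal {A} i {X Y} f.

Section QuotientCategory.
Variables (A : additive_category) (I : ideal A).
Implicit Types X Y Z : A.

Definition ideal_mem X Y : pred (hom X Y) := fun f => `[< in_ideal I f >].

Lemma ideal_mem_closed X Y : zmod_closed (@ideal_mem X Y).
Proof.
split; first by apply/asboolP; exact: ideal0.
by move=> f g /asboolP If /asboolP Ig; apply/asboolP; exact: idealB.
Qed.

HB.instance Definition _ X Y :=
  GRing.isZmodClosed.Build (hom X Y) (@ideal_mem X Y) (@ideal_mem_closed X Y).

Definition qhom X Y : zmodType :=
  Quotient.quot (GRing.ZmodClosed.clone _ (@ideal_mem X Y) _).

Definition qclass X Y (f : hom X Y) : qhom X Y := \pi_(qhom X Y) f.

Lemma qclassP X Y (f g : hom X Y) : qclass f = qclass g <-> in_ideal I (f - g).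
Proof.
split=> [/eqP|Ifg]; first by rewrite -Quotient.idealrBE => /asboolP.
by apply/eqP; rewrite -Quotient.idealrBE; apply/asboolP.
Qed.

Lemma qclass_repr X Y (f : qhom X Y) : qclass (repr f) = f.
Proof. exact: reprK. Qed.

Lemma qclassD X Y (f g : hom X Y) : qclass (f + g) = qclass f + qclass g.
Proof. exact: (raddfD \pi_(qhom X Y)). Qed.

Definition qcomp X Y Z (g : qhom Y Z) (f : qhom X Y) : qhom X Z :=
  qclass (repr g \co repr f).

Lemma qcompE X Y Z (g : hom Y Z) (f : hom X Y) :
  qcomp (qclass g) (qclass f) = qclass (g \co f).
Proof.
apply/qclassP; set g' := repr _; set f' := repr _.
have Ig : in_ideal I (g' - g) by apply/qclassP; rewrite qclass_repr.
have If : in_ideal I (f' - f) by apply/qclassP; rewrite qclass_repr.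
have -> : g' \co f' - g \co f = (g' - g) \co f' - g \co (- (f' - f)).
  by rewrite mcompDl !(mcompNm, mcompmN) opprK mcompDr mcompmN addrA addrNK.
apply: idealB; first exact: idealMr.
apply: idealMl; rewrite -sub0r; apply: idealB If; exact: ideal0.
Qed.

Definition quotient_category_base : preadditive_category.
Proof.
refine (@PreadditiveCategory A qhom (fun X => qclass (idm X)) qcomp _ _ _ _ _).
- move=> X Y Z T h g f.
  rewrite -[h]qclass_repr -[g]qclass_repr -[f]qclass_repr.
  by rewrite !qcompE mcompA.
- by move=> X Y f; rewrite -[f]qclass_repr qcompE mcomp1m.
- by move=> X Y f; rewrite -[f]qclass_repr qcompE mcompm1.
- move=> X Y Z g g' f.
  rewrite -[g]qclass_repr -[g']qclass_repr -[f]qclass_repr.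
  by rewrite -qclassD !qcompE mcompDl qclassD.
- move=> X Y Z g f f'.
  rewrite -[g]qclass_repr -[f]qclass_repr -[f']qclass_repr.
  by rewrite -qclassD !qcompE mcompDr qclassD.
Defined.

Lemma quotient_zero : exists Z : quotient_category_base, is_zero_object Z.
Proof.
have [Z Z0] := zero_object_exists A; exists Z.
by rewrite /is_zero_object /= Z0; exact: (raddf0 \pi_(qhom Z Z)).
Qed.

Lemma quotient_biproduct (X Y : quotient_category_base) :
  exists (S : quotient_category_base) (i1 : hom X S) (i2 : hom Y S)
    (p1 : hom S X) (p2 : hom S Y), is_biproduct i1 i2 p1 p2.
Proof.
have [S [i1 [i2 [p1 [p2 [b1 b2 b3 b4 b5]]]]]] := @biproduct_exists A X Y.
exists S, (qclass i1), (qclass i2), (qclass p1), (qclass p2).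
have q0 U W : qclass (0 : hom U W) = 0 by exact: (raddf0 \pi_(qhom U W)).
by split; rewrite /= !qcompE ?b1 ?b2 ?b3 ?b4 -?qclassD ?b5 ?q0.
Qed.

Definition quotient_category : additive_category :=
  AdditiveCategory quotient_zero quotient_biproduct.

End QuotientCategory.

Definition zmod_short_exact (A B C : zmodType) (f : A -> B) (g : B -> C) :=
  [/\ injective f, forall y, g y = 0 <-> exists x, f x = y
    & forall z, exists y, g y = z].

(** A class of composable pairs [X --> Y --> Z], thought of as
    [0 -> X -> Y -> Z -> 0]. *)
Definition sequence_class (A : preadditive_category) :=
  forall X Y Z : A, hom X Y -> hom Y Z -> Prop.

Section RelativeProjectives.
Variables (A : additive_category) (E : sequence_class A).

Definition rel_projective (P : A) :=
  forall (X Y Z : A) (f : hom X Y) (g : hom Y Z), E f g ->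
    zmod_short_exact (fun h : hom P X => f \co h) (fun h : hom P Y => g \co h).

Definition factors_through_projective (X Y : A) (f : hom X Y) :=
  exists (P : A) (a : hom X P) (b : hom P Y),
    rel_projective P /\ f = b \co a.

Lemma rel_projective_zero (Z : A) : is_zero_object Z -> rel_projective Z.
Proof.
move=> Z0 X Y W f g _.
have h0 T (h : hom Z T) : h = 0 by rewrite -(mcompm1 h) Z0 mcompm0.
split=> [h h' _|h|h]; first by rewrite (h0 _ h) (h0 _ h').
  by split=> _; [exists 0; rewrite mcompm0 (h0 _ h)|rewrite (h0 _ h) mcompm0].
by exists 0; rewrite mcompm0 (h0 _ h).
Qed.

Lemma rel_projective_biproduct (P Q S : A) (i1 : hom P S) (i2 : hom Q S)
    (p1 : hom S P) (p2 : hom S Q) :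
  is_biproduct i1 i2 p1 p2 ->
  rel_projective P -> rel_projective Q -> rel_projective S.
Proof.
move=> [p1i1 p2i2 p1i2 p2i1 idS] projP projQ X Y Z f g Efg.
have [injP kerP surP] := projP _ _ _ _ _ Efg.
have [injQ kerQ surQ] := projQ _ _ _ _ _ Efg.
have dec T (h : hom S T) : h = (h \co i1) \co p1 + (h \co i2) \co p2.
  by rewrite -!mcompA -mcompDr idS mcompm1.
split=> [h h' /= eq_h|h|h].
- have eq1 : h \co i1 = h' \co i1 by apply: injP; rewrite !mcompA eq_h.
  have eq2 : h \co i2 = h' \co i2 by apply: injQ; rewrite !mcompA eq_h.
  by rewrite (dec _ h) (dec _ h') eq1 eq2.
- split=> [gh0|[h' <-]].
    have [|a fa] := (kerP (h \co i1)).1; first by rewrite mcompA gh0 mcomp0m.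
    have [|b fb] := (kerQ (h \co i2)).1; first by rewrite mcompA gh0 mcomp0m.
    by exists (a \co p1 + b \co p2); rewrite mcompDr !mcompA fa fb -dec.
  rewrite (dec _ h') !mcompDr !mcompA.
  rewrite -[_ \co _ \co i1]mcompA -[_ \co _ \co i2]mcompA.
  have -> : g \co f \co (h' \co i1) = 0.
    by rewrite -mcompA; apply/kerP; exists (h' \co i1).
  have -> : g \co f \co (h' \co i2) = 0.
    by rewrite -mcompA; apply/kerQ; exists (h' \co i2).
  by rewrite !mcomp0m addr0.
have [a ga] := surP (h \co i1); have [b gb] := surQ (h \co i2).
by exists (a \co p1 + b \co p2); rewrite mcompDr !mcompA ga gb -dec.
Qed.

Definition projective_ideal : ideal A.
Proof.
refine (@Ideal A factors_through_projective _ _ _ _).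
- move=> X Y; have [Z Z0] := zero_object_exists A.
  exists Z, 0, 0; split; [exact: rel_projective_zero|by rewrite mcompm0].
- move=> X Y f f' [P [a [b [projP ->]]]] [Q [a' [b' [projQ ->]]]].
  have [S [i1 [i2 [p1 [p2 bS]]]]] := biproduct_exists P Q.
  exists S, (i1 \co a + i2 \co a'), (b \co p1 - b' \co p2); split.
    exact: rel_projective_biproduct bS projP projQ.
  case: bS => p1i1 p2i2 p1i2 p2i1 _.
  rewrite mcompDr !mcompA !mcompDl !mcompNm.
  rewrite -!(mcompA b) -!(mcompA b') p1i1 p2i1 p1i2 p2i2.
  by rewrite !mcomp1m !mcomp0m !mcompm0 oppr0 addr0 add0r.
- move=> X Y Z g f [P [a [b [projP ->]]]].
  by exists P, a, (g \co b); rewrite mcompA.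
- move=> X Y Z g f [P [a [b [projP ->]]]].
  by exists P, (a \co f), b; rewrite mcompA.
Defined.

Definition stable_category : additive_category :=
  quotient_category projective_ideal.

End RelativeProjectives.

Record additive_functor (A B : preadditive_category) := AdditiveFunctor {
  fobj :> A -> B;
  fmap : forall X Y : A, hom X Y -> hom (fobj X) (fobj Y);
  fmap1 : forall X : A, fmap (idm X) = idm (fobj X);
  fmapM : forall (X Y Z : A) (g : hom Y Z) (f : hom X Y),
    fmap (g \co f) = fmap g \co fmap f;
  fmapD : forall (X Y : A) (f g : hom X Y), fmap (f + g) = fmap f + fmap g
}.

Arguments fmap {A B} a {X Y} f.

Lemma fmap0 (A B : preadditive_category) (F : additive_functor A B) (X Y : A) :
  fmap F (0 : hom X Y) = 0.
Proof. by apply: (addrI (fmap F 0)); rewrite -fmapD !addr0. Qed.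

Section Complexes.
Variable A : additive_category.

Record complex := Complex {
  term :> int -> A;
  diff : forall n : int, hom (term n) (term (n + 1));
  diffK : forall n, diff (n + 1) \co diff n = 0
}.

Record chain_map (X Y : complex) := ChainMap {
  degree :> forall n : int, hom (X n) (Y n);
  degreeP : forall n, diff Y n \co degree n = degree (n + 1) \co diff X n
}.

HB.instance Definition _ X Y := gen_eqMixin (chain_map X Y).
HB.instance Definition _ X Y := gen_choiceMixin (chain_map X Y).

Lemma chain_map_ext X Y (f g : chain_map X Y) : (forall n, f n = g n) -> f = g.
Proof.
case: f g => [f fP] [g gP] /= eqfg.
have eq_fg : f = g by apply: functional_extensionality_dep.
by case: _ / eq_fg gP => gP; congr ChainMap; exact: Prop_irrelevance.
Qed.

Section ChainMapZmod.
Variables X Y : complex.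
Implicit Types f g : chain_map X Y.

Definition chain_zero : chain_map X Y.
Proof.
by refine (@ChainMap X Y (fun n => 0) _) => n; rewrite mcompm0 mcomp0m.
Defined.

Definition chain_opp f : chain_map X Y.
Proof.
by refine (@ChainMap X Y (fun n => - f n) _) => n;
  rewrite mcompmN mcompNm degreeP.
Defined.

Definition chain_add f g : chain_map X Y.
Proof.
by refine (@ChainMap X Y (fun n => f n + g n) _) => n;
  rewrite mcompDl mcompDr !degreeP.
Defined.

Lemma chain_addA : associative chain_add.
Proof. by move=> f g h; apply: chain_map_ext => n /=; rewrite addrA. Qed.
Lemma chain_addC : commutative chain_add.
Proof. by move=> f g; apply: chain_map_ext => n /=; rewrite addrC. Qed.
Lemma chain_add0 : left_id chain_zero chain_add.
Proof. by move=> f; apply: chain_map_ext => n /=; rewrite add0r. Qed.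
Lemma chain_addN : left_inverse chain_zero chain_opp chain_add.
Proof. by move=> f; apply: chain_map_ext => n /=; rewrite addNr. Qed.

HB.instance Definition _ := GRing.isZmodule.Build (chain_map X Y)
  chain_addA chain_addC chain_add0 chain_addN.

End ChainMapZmod.

Definition chain_id X : chain_map X X.
Proof.
by refine (@ChainMap X X (fun n => idm (X n)) _) => n; rewrite mcompm1 mcomp1m.
Defined.

Definition chain_comp X Y Z (g : chain_map Y Z) (f : chain_map X Y) :
  chain_map X Z.
Proof.
by refine (@ChainMap X Z (fun n => g n \co f n) _) => n;
  rewrite mcompA degreeP -mcompA degreeP mcompA.
Defined.

Definition cpx_base : preadditive_category.
Proof.
refine (@PreadditiveCategory complex (fun X Y => chain_map X Y : zmodType)
  chain_id chain_comp _ _ _ _ _).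
- by move=> X Y Z T h g f; apply: chain_map_ext => n /=; rewrite mcompA.
- by move=> X Y f; apply: chain_map_ext => n /=; rewrite mcomp1m.
- by move=> X Y f; apply: chain_map_ext => n /=; rewrite mcompm1.
- by move=> X Y Z g g' f; apply: chain_map_ext => n /=; rewrite mcompDl.
- by move=> X Y Z g f f'; apply: chain_map_ext => n /=; rewrite mcompDr.
Defined.

Lemma cpx_zero : exists Z : cpx_base, is_zero_object Z.
Proof.
have [Z Z0] := zero_object_exists A.
have dd (n : int) : (0 : hom Z Z) \co (0 : hom Z Z) = 0 by rewrite mcompm0.
by exists (@Complex (fun _ => Z) (fun _ => 0) dd); apply: chain_map_ext.
Qed.

Lemma cpx_biproduct (X Y : cpx_base) :
  exists (S : cpx_base) (i1 : hom X S) (i2 : hom Y S)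
    (p1 : hom S X) (p2 : hom S Y), is_biproduct i1 i2 p1 p2.
Proof.
have bXY n : {S : A & {i1 : hom (term X n) S & {i2 : hom (term Y n) S &
    {p1 : hom S (term X n) & {p2 : hom S (term Y n)
      | is_biproduct i1 i2 p1 p2}}}}}.
  have /cid[S /cid[i1 /cid[i2 /cid[p1 /cid[p2 b]]]]] :=
    biproduct_exists (term X n) (term Y n).
  by exists S, i1, i2, p1, p2.
pose S n := projT1 (bXY n).
pose i1 n : hom (term X n) (S n) := projT1 (projT2 (bXY n)).
pose i2 n : hom (term Y n) (S n) := projT1 (projT2 (projT2 (bXY n))).
pose p1 n : hom (S n) (term X n) := projT1 (projT2 (projT2 (projT2 (bXY n)))).
pose p2 n : hom (S n) (term Y n) :=
  sval (projT2 (projT2 (projT2 (projT2 (bXY n))))).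
have b n : is_biproduct (i1 n) (i2 n) (p1 n) (p2 n).
  exact: svalP (projT2 (projT2 (projT2 (projT2 (bXY n))))).
clearbody S i1 i2 p1 p2; clear bXY.
pose dS n : hom (S n) (S (n + 1)) :=
  i1 (n + 1) \co diff X n \co p1 n + i2 (n + 1) \co diff Y n \co p2 n.
have dSi1 n : dS n \co i1 n = i1 (n + 1) \co diff X n.
  have [e1 e2 e3 e4 _] := b n.
  by rewrite mcompDl -!mcompA e1 e4 !mcompm0 mcompm1 addr0.
have dSi2 n : dS n \co i2 n = i2 (n + 1) \co diff Y n.
  have [e1 e2 e3 e4 _] := b n.
  by rewrite mcompDl -!mcompA e2 e3 !mcompm0 mcompm1 add0r.
have p1dS n : p1 (n + 1) \co dS n = diff X n \co p1 n.
  have [e1 e2 e3 e4 _] := b (n + 1).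
  by rewrite mcompDr !mcompA e1 e3 !mcomp0m mcomp1m addr0.
have p2dS n : p2 (n + 1) \co dS n = diff Y n \co p2 n.
  have [e1 e2 e3 e4 _] := b (n + 1).
  by rewrite mcompDr !mcompA e2 e4 !mcomp0m mcomp1m add0r.
have dSK n : dS (n + 1) \co dS n = 0.
  rewrite {2}/dS mcompDr !mcompA dSi1 dSi2.
  rewrite -[_ \co diff X n]mcompA -[_ \co diff Y n]mcompA !diffK.
  by rewrite !mcompm0 !mcomp0m addr0.
exists (Complex dSK : cpx_base), (ChainMap (X := X) (Y := Complex dSK) dSi1),
  (ChainMap (X := Y) (Y := Complex dSK) dSi2),
  (ChainMap (X := Complex dSK) (Y := X) (fun n => esym (p1dS n))),
  (ChainMap (X := Complex dSK) (Y := Y) (fun n => esym (p2dS n))).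
by split; apply: chain_map_ext => n; have [] := b n.
Qed.

Definition cpx : additive_category :=
  AdditiveCategory cpx_zero cpx_biproduct.

End Complexes.

Section BoundedComplexes.
Variable A : additive_category.

Definition bounded_above (X : cpx A) :=
  exists N : int, forall n, N < n -> is_zero_object (term X n).

Definition bounded_below (X : cpx A) :=
  exists N : int, forall n, n < N -> is_zero_object (term X n).

(** The bound is named rather than signed, since the literature disagrees on
    which of [Cpx^+] and [Cpx^-] is bounded above. *)
Variant bound := Unbounded | BoundedAbove | BoundedBelow | Bounded.

Definition satisfies_bound (b : bound) (X : cpx A) : Prop :=
  match b with
  | Unbounded => True
  | BoundedAbove => bounded_above X
  | BoundedBelow => bounded_below X
  | Bounded => bounded_above X /\ bounded_below X
  end.

Lemma zero_object_degree (X : cpx A) n :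
  is_zero_object X -> is_zero_object (term X n).
Proof. by move=> /(congr1 (fun f : chain_map X X => f n)). Qed.

Lemma satisfies_bound_zero b (Z : cpx A) :
  is_zero_object Z -> satisfies_bound b Z.
Proof.
move=> Z0.
have up : bounded_above Z by exists 0 => n _; exact: zero_object_degree.
have lo : bounded_below Z by exists 0 => n _; exact: zero_object_degree.
by case: b.
Qed.

Lemma biproduct_degree_zero (X Y S : cpx A) (i1 : hom X S) (i2 : hom Y S)
    (p1 : hom S X) (p2 : hom S Y) n :
  is_biproduct i1 i2 p1 p2 -> is_zero_object (term X n) ->
  is_zero_object (term Y n) -> is_zero_object (term S n).
Proof.
case=> _ _ _ _ /(congr1 (fun f : chain_map S S => f n)) /= idS X0 Y0.
rewrite /is_zero_object -[LHS]idS.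
rewrite -[degree i1 n]mcompm1 -[degree i2 n]mcompm1 X0 Y0.
by rewrite !mcompm0 !mcomp0m addr0.
Qed.

Lemma satisfies_bound_biproduct b (X Y S : cpx A) (i1 : hom X S)
    (i2 : hom Y S) (p1 : hom S X) (p2 : hom S Y) :
  is_biproduct i1 i2 p1 p2 ->
  satisfies_bound b X -> satisfies_bound b Y -> satisfies_bound b S.
Proof.
move=> bS; have degS n := biproduct_degree_zero (n := n) bS.
have up : bounded_above X -> bounded_above Y -> bounded_above S.
  move=> [N XN] [N' YN]; exists (Order.max N N') => n.
  by rewrite Order.TotalTheory.gt_max => /andP[? ?]; apply: degS; auto.
have lo : bounded_below X -> bounded_below Y -> bounded_below S.
  move=> [N XN] [N' YN]; exists (Order.min N N') => n.
  by rewrite Order.TotalTheory.lt_min => /andP[? ?]; apply: degS; auto.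
by case: b => //=; case=> ? ? [? ?]; split; auto.
Qed.

Definition bounded_cpx (b : bound) : additive_category :=
  full_subcategory (@satisfies_bound_zero b) (@satisfies_bound_biproduct b).

End BoundedComplexes.

Section ComplexFunctor.
Variables (A B : additive_category) (F : additive_functor A B).

Definition cpx_fobj (X : complex A) : complex B.
Proof.
refine (@Complex B (fun n => F (X n)) (fun n => fmap F (diff X n)) _) => n.
by rewrite -fmapM diffK fmap0.
Defined.

Definition cpx_fmap (X Y : complex A) (f : chain_map X Y) :
  chain_map (cpx_fobj X) (cpx_fobj Y).
Proof.
refine (@ChainMap B (cpx_fobj X) (cpx_fobj Y) (fun n => fmap F (f n)) _) => n.
by rewrite /= -!fmapM degreeP.
Defined.

Definition cpx_functor : additive_functor (cpx A) (cpx B).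
Proof.
refine (@AdditiveFunctor (cpx A) (cpx B) cpx_fobj cpx_fmap _ _ _).
- by move=> X; apply: chain_map_ext => n /=; rewrite fmap1.
- by move=> X Y Z g f; apply: chain_map_ext => n /=; rewrite fmapM.
- by move=> X Y f g; apply: chain_map_ext => n /=; rewrite fmapD.
Defined.

End ComplexFunctor.

Section Modules.
Variables (k : comPzRingType) (G : finGroupType).

(** A left [kG]-module, presented as a [k]-module with a [k]-linear left action
    of [G]. *)
Record kGmodule := KGmodule {
  carrier :> lmodType k;
  act : G -> carrier -> carrier;
  act_linear : forall g, linear (act g);
  act1 : forall x, act 1%g x = x;
  actM : forall g h x, act (g * h)%g x = act g (act h x)
}.

Lemma actD (M : kGmodule) g (x y : M) : act g (x + y) = act g x + act g y.
Proof. by have := act_linear g 1 x y; rewrite !scale1r. Qed.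

Lemma act0 (M : kGmodule) g : act g (0 : M) = 0.
Proof. by apply: (addrI (act g 0)); rewrite -actD !addr0. Qed.

Lemma actZ (M : kGmodule) g a (x : M) : act g (a *: x) = a *: act g x.
Proof. by have := act_linear g a x 0; rewrite !addr0 act0 addr0. Qed.

Record kGhom (M N : kGmodule) := KGhom {
  kGfun :> M -> N;
  kGfun_linear : linear kGfun;
  kGfun_act : forall g x, kGfun (act g x) = act g (kGfun x)
}.

HB.instance Definition _ M N := gen_eqMixin (kGhom M N).
HB.instance Definition _ M N := gen_choiceMixin (kGhom M N).
HB.instance Definition _ (M N : kGmodule) (f : kGhom M N) :=
  GRing.isLinear.Build k M N *:%R f (kGfun_linear f).

Lemma kGhom_ext M N (f g : kGhom M N) : f =1 g -> f = g.
Proof.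
case: f g => [f fl fa] [g gl ga] /= /funext eqfg.
by case: _ / eqfg gl ga => gl ga; congr KGhom; exact: Prop_irrelevance.
Qed.

Section KGhomZmod.
Variables M N : kGmodule.
Implicit Types f g : kGhom M N.

Definition kGhom_zero : kGhom M N.
Proof.
refine (@KGhom M N (fun=> 0) _ _) => [a x y|g x]; last by rewrite act0.
by rewrite scaler0 addr0.
Defined.

Definition kGhom_add f g : kGhom M N.
Proof.
refine (@KGhom M N (fun x => f x + g x) _ _) => [a x y|h x].
  by rewrite !linearP scalerDr addrACA.
by rewrite !kGfun_act actD.
Defined.

Definition kGhom_opp f : kGhom M N.
Proof.
refine (@KGhom M N (fun x => - f x) _ _) => [a x y|h x].
  by rewrite linearP opprD scalerN.
by rewrite kGfun_act -scaleN1r -actZ scaleN1r.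
Defined.

Lemma kGhom_addA : associative kGhom_add.
Proof. by move=> f g h; apply: kGhom_ext => x /=; rewrite addrA. Qed.
Lemma kGhom_addC : commutative kGhom_add.
Proof. by move=> f g; apply: kGhom_ext => x /=; rewrite addrC. Qed.
Lemma kGhom_add0 : left_id kGhom_zero kGhom_add.
Proof. by move=> f; apply: kGhom_ext => x /=; rewrite add0r. Qed.
Lemma kGhom_addN : left_inverse kGhom_zero kGhom_opp kGhom_add.
Proof. by move=> f; apply: kGhom_ext => x /=; rewrite addNr. Qed.

HB.instance Definition _ := GRing.isZmodule.Build (kGhom M N)
  kGhom_addA kGhom_addC kGhom_add0 kGhom_addN.

End KGhomZmod.

Definition kGhom_id M : kGhom M M := @KGhom M M id (fun _ _ _ => erefl)
  (fun _ _ => erefl).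

Definition kGhom_comp M N L (g : kGhom N L) (f : kGhom M N) : kGhom M L.
Proof.
refine (@KGhom M L (fun x => g (f x)) _ _) => [a x y|h x].
  by rewrite !linearP.
by rewrite !kGfun_act.
Defined.

Definition Mod_base : preadditive_category.
Proof.
refine (@PreadditiveCategory kGmodule (fun M N => kGhom M N : zmodType)
  kGhom_id kGhom_comp _ _ _ _ _).
- by move=> *; exact: kGhom_ext.
- by move=> *; exact: kGhom_ext.
- by move=> *; exact: kGhom_ext.
- by move=> *; exact: kGhom_ext.
- by move=> M N L g f f'; apply: kGhom_ext => x /=; rewrite linearD.
Defined.

Lemma Mod_zero : exists Z : Mod_base, is_zero_object Z.
Proof.
pose Z : lmodType k := 'rV[k]_0.
exists (@KGmodule Z (fun _ => id) (fun _ _ _ _ => erefl) (fun=> erefl)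
  (fun _ _ _ => erefl) : Mod_base).
by apply: kGhom_ext => x; apply/rowP => -[].
Qed.

Section DirectSum.
Variables M N : kGmodule.

Definition dsum : kGmodule.
Proof.
refine (@KGmodule (M * N)%type (fun g x => (act g x.1, act g x.2)) _ _ _).
- by move=> g a x y; rewrite /= !actD !actZ.
- by case=> x y; rewrite /= !act1.
- by move=> g h x; rewrite /= !actM.
Defined.

Definition dsum_in1 : kGhom M dsum.
Proof.
refine (@KGhom M dsum (fun x => (x, 0)) _ _) => [a x y|g x] /=.
  by congr (_, _); rewrite /= scaler0 addr0.
by rewrite act0.
Defined.

Definition dsum_in2 : kGhom N dsum.
Proof.
refine (@KGhom N dsum (fun x => (0, x)) _ _) => [a x y|g x] /=.
  by congr (_, _); rewrite /= scaler0 addr0.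
by rewrite act0.
Defined.

Definition dsum_out1 : kGhom dsum M := @KGhom dsum M fst
  (fun _ _ _ => erefl) (fun _ _ => erefl).
Definition dsum_out2 : kGhom dsum N := @KGhom dsum N snd
  (fun _ _ _ => erefl) (fun _ _ => erefl).

End DirectSum.

Lemma Mod_biproduct (M N : Mod_base) :
  exists (S : Mod_base) (i1 : hom M S) (i2 : hom N S)
    (p1 : hom S M) (p2 : hom S N), is_biproduct i1 i2 p1 p2.
Proof.
exists (dsum M N : Mod_base), (dsum_in1 M N), (dsum_in2 M N),
  (dsum_out1 M N), (dsum_out2 M N).
split; apply: kGhom_ext => x //.
by case: x => x y; congr (_, _); rewrite /= ?addr0 ?add0r.
Qed.

Definition Mod : additive_category :=
  AdditiveCategory Mod_zero Mod_biproduct.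

Definition free_of_finite_rank (M : lmodType k) :=
  exists (n : nat) (b : 'I_n -> M),
    forall x : M, exists! c : {ffun 'I_n -> k}, x = \sum_(i < n) c i *: b i.

End Modules.

Section Tensor.
Variable k : comPzRingType.

Definition is_bilinear (V M W : lmodType k) (b : V -> M -> W) :=
  (forall v, linear (b v)) /\ (forall m, linear (b^~ m)).

Section Construction.
Variables V M : lmodType k.
Implicit Types s t : seq (V * M).

Definition tens_eval (W : lmodType k) (b : V -> M -> W) s : W :=
  \sum_(p <- s) b p.1 p.2.

(** A list of pairs stands for the formal sum of the [p.1 (x) p.2]; two formal
    sums are identified when no bilinear map separates them.  The universal
    property of the quotient is [tens_universal] below. *)
Definition tens_equiv s t :=
  forall (W : lmodType k) (b : V -> M -> W),
    is_bilinear b -> tens_eval b s = tens_eval b t.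

Definition tens_rel s t := `[< tens_equiv s t >].

Lemma tens_rel_equiv : equiv_class_of tens_rel.
Proof.
split=> [s|s t|t s u]; first by apply/asboolP.
  by apply/asboolP/asboolP => h W b bb; rewrite h.
move=> /asboolP st /asboolP tu; apply/asboolP => W b bb.
by rewrite st // tu.
Qed.

Canonical tens_equiv_rel := EquivRelPack tens_rel_equiv.
Canonical tens_encModRel := defaultEncModRel tens_rel.

Definition tensor := {eq_quot tens_rel}.

HB.instance Definition _ : EqQuotient (seq (V * M)) tens_rel tensor :=
  EqQuotient.on tensor.
HB.instance Definition _ := Choice.on tensor.

Definition tclass s : tensor := \pi_tensor s.

Lemma tclassP s t : tclass s = tclass t <-> tens_equiv s t.
Proof.
by split=> [/eqmodP/asboolP //|st]; apply/eqmodP/asboolP.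
Qed.

Lemma tclass_repr (x : tensor) : tclass (repr x) = x.
Proof. exact: reprK. Qed.

Lemma repr_tclass s : tens_equiv (repr (tclass s)) s.
Proof. by apply/tclassP; rewrite tclass_repr. Qed.

Definition tens_scale_seq (a : k) s := [seq (a *: p.1, p.2) | p <- s].

Lemma tens_eval_cat (W : lmodType k) (b : V -> M -> W) s t :
  tens_eval b (s ++ t) = tens_eval b s + tens_eval b t.
Proof. exact: big_cat. Qed.

Lemma tens_eval_scale (W : lmodType k) (b : V -> M -> W) a s :
  is_bilinear b -> tens_eval b (tens_scale_seq a s) = a *: tens_eval b s.
Proof.
case=> _ bl; rewrite /tens_eval big_map scaler_sumr; apply: eq_bigr => p _.
pose f : {linear V -> W} := HB.pack (b^~ p.2)
  (GRing.isLinear.Build k V W *:%R (b^~ p.2) (bl p.2)).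
exact: (linearZZ f).
Qed.

Definition tens_zero := tclass [::].
Definition tens_add (x y : tensor) := tclass (repr x ++ repr y).
Definition tens_scale a (x : tensor) := tclass (tens_scale_seq a (repr x)).
Definition tens_opp := tens_scale (- 1).

Lemma tens_addE s t : tens_add (tclass s) (tclass t) = tclass (s ++ t).
Proof.
by apply/tclassP => W b bb; rewrite !tens_eval_cat !repr_tclass.
Qed.

Lemma tens_scaleE a s :
  tens_scale a (tclass s) = tclass (tens_scale_seq a s).
Proof.
by apply/tclassP => W b bb; rewrite !tens_eval_scale // repr_tclass.
Qed.

Lemma tens_addA : associative tens_add.
Proof.
move=> x y z; rewrite -[x]tclass_repr -[y]tclass_repr -[z]tclass_repr.
by rewrite !tens_addE catA.
Qed.

Lemma tens_addC : commutative tens_add.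
Proof.
move=> x y; apply/tclassP => W b bb.
by rewrite !tens_eval_cat addrC.
Qed.

Lemma tens_add0 : left_id tens_zero tens_add.
Proof. by move=> x; rewrite -[x]tclass_repr tens_addE. Qed.

Lemma tens_addN : left_inverse tens_zero tens_opp tens_add.
Proof.
move=> x; rewrite -[x]tclass_repr /tens_opp tens_scaleE tens_addE.
apply/tclassP => W b bb.
by rewrite tens_eval_cat tens_eval_scale // scaleN1r addNr /tens_eval big_nil.
Qed.

HB.instance Definition _ := GRing.isZmodule.Build tensor
  tens_addA tens_addC tens_add0 tens_addN.

Lemma tclassD s t : tclass s + tclass t = tclass (s ++ t).
Proof. exact: tens_addE. Qed.

Lemma tens_scaleA a b x : tens_scale a (tens_scale b x) = tens_scale (a * b) x.
Proof.
rewrite -[x]tclass_repr !tens_scaleE; apply/tclassP => W c cc.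
by rewrite !tens_eval_scale // scalerA.
Qed.

Lemma tens_scale1 : left_id 1 tens_scale.
Proof.
move=> x; rewrite -[x]tclass_repr !tens_scaleE; apply/tclassP => W c cc.
by rewrite !tens_eval_scale // scale1r.
Qed.

Lemma tens_scaleDr : right_distributive tens_scale +%R.
Proof.
move=> a x y; rewrite -[x]tclass_repr -[y]tclass_repr.
rewrite tclassD !tens_scaleE tclassD; apply/tclassP => W c cc.
by rewrite !(tens_eval_cat, tens_eval_scale) // scalerDr.
Qed.

Lemma tens_scaleDl x : {morph tens_scale^~ x : a b / a + b}.
Proof.
move=> a b; rewrite -[x]tclass_repr !tens_scaleE tclassD.
apply/tclassP => W c cc.
by rewrite !(tens_eval_cat, tens_eval_scale) // scalerDl.
Qed.

HB.instance Definition _ := GRing.Zmodule_isLmodule.Build k tensor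
  tens_scaleA tens_scale1 tens_scaleDr tens_scaleDl.

Lemma tclassZ a s : a *: tclass s = tclass (tens_scale_seq a s).
Proof. exact: tens_scaleE. Qed.

Definition tens (v : V) (m : M) : tensor := tclass [:: (v, m)].

Lemma tens_bilinear : is_bilinear tens.
Proof.
split=> [v|m] a x y; rewrite tclassZ tclassD; apply/tclassP => W b bb;
  rewrite tens_eval_cat tens_eval_scale // /tens_eval !big_seq1 /=;
  case: bb => b1 b2; [exact: b1|exact: b2].
Qed.

Lemma tclass_sum s : tclass s = \sum_(p <- s) tens p.1 p.2.
Proof.
elim: s => [|[v m] s IH]; first by rewrite big_nil.
by rewrite big_cons -IH tclassD.
Qed.

Definition tens_lift (W : lmodType k) (b : V -> M -> W) (x : tensor) : W :=
  tens_eval b (repr x).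

Lemma tens_liftE (W : lmodType k) (b : V -> M -> W) s :
  is_bilinear b -> tens_lift b (tclass s) = tens_eval b s.
Proof. exact: repr_tclass. Qed.

Lemma tens_lift_tens (W : lmodType k) (b : V -> M -> W) v m :
  is_bilinear b -> tens_lift b (tens v m) = b v m.
Proof. by move=> bb; rewrite tens_liftE // /tens_eval big_seq1. Qed.

Lemma tens_lift_linear (W : lmodType k) (b : V -> M -> W) :
  is_bilinear b -> linear (tens_lift b).
Proof.
move=> bb a x y; rewrite -[x]tclass_repr -[y]tclass_repr.
rewrite tclassZ tclassD !tens_liftE //.
by rewrite tens_eval_cat tens_eval_scale.
Qed.

Lemma linear_sum_fun (U W : lmodType k) (f : U -> W) (I : Type) (r : seq I)
  (F : I -> U) : linear f -> f (\sum_(i <- r) F i) = \sum_(i <- r) f (F i).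
Proof.
move=> fl; pose g : {linear U -> W} :=
  HB.pack f (GRing.isLinear.Build k U W *:%R f fl).
exact: (linear_sum g).
Qed.

Lemma tens_ext (W : lmodType k) (f g : tensor -> W) : linear f -> linear g ->
  (forall v m, f (tens v m) = g (tens v m)) -> f =1 g.
Proof.
move=> fl gl eqfg x; rewrite -[x]tclass_repr tclass_sum !linear_sum_fun //.
exact: eq_bigr.
Qed.

Lemma tens_universal (W : lmodType k) (b : V -> M -> W) : is_bilinear b ->
  exists! f : tensor -> W, linear f /\ forall v m, f (tens v m) = b v m.
Proof.
move=> bb; exists (tens_lift b); split.
  by split=> [|v m]; [exact: tens_lift_linear|exact: tens_lift_tens].
move=> f [fl fb]; apply/funext; apply: tens_ext => //.
  exact: tens_lift_linear.
by move=> v m; rewrite tens_lift_tens // fb.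
Qed.

End Construction.

Lemma tens_comp_bilinear (V V' M M' : lmodType k) (f : V -> V') (g : M -> M') :
  linear f -> linear g -> is_bilinear (fun v m => tens (f v) (g m)).
Proof.
move=> fl gl; have [b1 b2] := tens_bilinear V' M'.
by split=> [v|m] a x y; rewrite ?fl ?gl; [exact: b1|exact: b2].
Qed.

Definition tens_map (V V' M M' : lmodType k) (f : V -> V') (g : M -> M') :
    tensor V M -> tensor V' M' :=
  tens_lift (fun v m => tens (f v) (g m)).

End Tensor.

Section TensorFunctor.
Variables (k : comPzRingType) (G : finGroupType) (V : kGmodule k G).

Lemma id_linear (M : lmodType k) : linear (@id M). Proof. by []. Qed.

Definition tens_act (M : kGmodule k G) (g : G) : tensor V M -> tensor V M :=
  tens_map (act g : V -> V) (act g : M -> M).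

Lemma tens_act_linear (M : kGmodule k G) g : linear (@tens_act M g).
Proof. by apply: tens_lift_linear; apply: tens_comp_bilinear; exact: act_linear. Qed.

Lemma tens_act_tens (M : kGmodule k G) g (v : V) (m : M) :
  tens_act g (tens v m) = tens (act g v) (act g m).
Proof. by apply: tens_lift_tens; apply: tens_comp_bilinear; exact: act_linear. Qed.

Definition tens_kG (M : kGmodule k G) : kGmodule k G.
Proof.
refine (@KGmodule k G (tensor V M) (@tens_act M) (@tens_act_linear M) _ _).
- apply: tens_ext => [||v m]; [exact: tens_act_linear|exact: id_linear|].
  by rewrite tens_act_tens !act1.
- move=> g h; apply: tens_ext; first exact: tens_act_linear.
    by move=> a x y; rewrite !tens_act_linear.
  by move=> v m; rewrite !tens_act_tens !actM.
Defined.

Definition tens_fun (M N : kGmodule k G) (f : kGhom M N) :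
  tensor V M -> tensor V N := tens_map id f.

Lemma tens_fun_linear M N (f : kGhom M N) : linear (tens_fun f).
Proof.
apply: tens_lift_linear; apply: tens_comp_bilinear.
  exact: id_linear.
exact: kGfun_linear.
Qed.

Lemma tens_fun_tens M N (f : kGhom M N) (v : V) (m : M) :
  tens_fun f (tens v m) = tens v (f m).
Proof.
apply: tens_lift_tens; apply: tens_comp_bilinear; first exact: id_linear.
exact: kGfun_linear.
Qed.

Definition tens_hom M N (f : kGhom M N) : kGhom (tens_kG M) (tens_kG N).
Proof.
refine (@KGhom k G (tens_kG M) (tens_kG N) (tens_fun f) (tens_fun_linear f) _).
move=> g; apply: tens_ext => [a x y|a x y|v m] /=.
- by rewrite tens_act_linear tens_fun_linear.
- by rewrite tens_fun_linear tens_act_linear.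
- by rewrite !(tens_act_tens, tens_fun_tens) kGfun_act.
Defined.

Definition tensor_functor : additive_functor (Mod k G) (Mod k G).
Proof.
refine (@AdditiveFunctor (Mod k G) (Mod k G) tens_kG tens_hom _ _ _).
- move=> M; apply: kGhom_ext; apply: tens_ext => [||v m].
  + exact: tens_fun_linear.
  + exact: id_linear.
  + exact: tens_fun_tens.
- move=> M N L g f; apply: kGhom_ext; apply: tens_ext => [|a x y|v m] /=.
  + exact: tens_fun_linear.
  + by rewrite !tens_fun_linear.
  + by rewrite !tens_fun_tens.
- move=> M N f g; apply: kGhom_ext; apply: tens_ext => [|a x y|v m] /=.
  + exact: tens_fun_linear.
  + by rewrite !tens_fun_linear scalerDr addrACA.
  + have [b1 _] := tens_bilinear V N.
    rewrite !tens_fun_tens; have := b1 v 1 (f m) (g m).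
    by rewrite !scale1r.
Defined.

End TensorFunctor.

Section HomotopyCategories.
Variables (k : comPzRingType) (G : finGroupType).

Local Notation Cpx_kG := (cpx (Mod k G)).

Definition Cpx (b : bound) : additive_category := bounded_cpx (Mod k G) b.

Definition exact_sequence : sequence_class Cpx_kG :=
  fun X Y Z f g => forall n : int,
    zmod_short_exact (degree f n : kGhom _ _) (degree g n : kGhom _ _).

Definition termwise_split (X Y Z : Cpx_kG) (f : hom X Y) (g : hom Y Z) :=
  forall n : int, split_sequence (degree f n) (degree g n).

Definition term_split : sequence_class Cpx_kG :=
  fun X Y Z f g => exact_sequence f g /\ termwise_split f g.

Section Relative.
Variable V : kGmodule k G.

Local Notation tensV := (cpx_functor (tensor_functor V)).

Definition V_split : sequence_class Cpx_kG :=
  fun X Y Z f g => exact_sequence f g /\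
    split_sequence (fmap tensV f) (fmap tensV g).

Definition V_term_split : sequence_class Cpx_kG :=
  fun X Y Z f g => exact_sequence f g /\
    termwise_split (fmap tensV f) (fmap tensV g).

Definition term_and_V_split : sequence_class Cpx_kG :=
  fun X Y Z f g => term_split f g /\ V_split f g.

End Relative.

Section Categories.
Variable b : bound.

(** The sequences of the class [E] all of whose terms lie in [Cpx b]. *)
Definition sequences_in (E : sequence_class Cpx_kG) : sequence_class (Cpx b) :=
  fun X Y Z f g => E (full_val X) (full_val Y) (full_val Z) f g.

Definition K : additive_category := stable_category (sequences_in term_split).

Variable V : kGmodule k G.

Definition K_V_split : additive_category :=
  stable_category (sequences_in (V_split V)).

Definition K_V_ts : additive_category :=
  stable_category (sequences_in (V_term_split V)).

Definition K_ts_V_split : additive_category :=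
  stable_category (sequences_in (term_and_V_split V)).

End Categories.

End HomotopyCategories.

(* Main.v *)
(** The argument is an Eilenberg swindle that works in the stable category of
    any idempotent complete additive category with countable copowers [X^(N)],
    whatever the class of sequences.  A summand [X'] of [X] cut out by a stable
    idempotent [e] satisfies [X' (+) X^(N) = X^(N)], hence is the kernel of a
    split epimorphism of [X^(N)], namely the one that shifts the [e]-part down
    by one summand and is the identity on the complementary part.  In the stable
    category split epimorphisms have kernels, since they lift to split
    epimorphisms [X (+) P -> Y] with [P] projective.  Only copowers of a single
    object are used: these exist in all four categories, because they keep the
    bounds of [X], whereas general countable coproducts do not. *)
From HB Require Import structures.
From mathcomp Require Import all_boot all_order all_algebra all_fingroup.
From mathcomp Require Import boolp functions.
Require Import Defs.

Set Implicit Arguments.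
Unset Strict Implicit.
Unset Printing Implicit Defensive.

Import GRing.Theory.
Local Open Scope ring_scope.

(** * Split idempotents and the swindle in a preadditive category *)

Section Splitting.
Variable A : preadditive_category.

(** Only the image of [e] is asked for. The complementary summand is the image of [idm X - e], so a
    proof for all idempotents at once may ignore it. *)
Definition retract_splits (X : A) (e : hom X X) :=
  exists (Y : A) (i : hom Y X) (p : hom X Y), p \co i = idm Y /\ i \co p = e.

Lemma mcompBl (X Y Z : A) (g g' : hom Y Z) (f : hom X Y) :
  (g - g') \co f = g \co f - g' \co f.
Proof. by rewrite mcompDl mcompNm. Qed.

Lemma mcompBr (X Y Z : A) (g : hom Y Z) (f f' : hom X Y) :
  g \co (f - f') = g \co f - g \co f'.
Proof. by rewrite mcompDr mcompmN. Qed.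

Lemma idempotent_compl (X : A) (e : hom X X) : e \co e = e ->
  (idm X - e) \co (idm X - e) = idm X - e.
Proof.
by move=> ee; rewrite mcompBl !mcompBr ee mcomp1m mcompm1 mcomp1m subrr subr0.
Qed.

Lemma idempotent_splits_retract (X : A) (e : hom X X) :
  idempotent_splits e -> retract_splits e.
Proof.
move=> [Y [Z [i [j [p [q [[pi _ _ _ sum] ei ej]]]]]]]; exists Y, i, p.
by split=> //; rewrite -[e in RHS]mcompm1 -sum mcompDr !mcompA ei ej mcomp0m addr0.
Qed.

(** Orthogonality of [e] and [idm X - e] makes the cross terms [p \co j] and [q \co i] vanish, so
    the two images form a biproduct. *)
Lemma retract_splits_idempotent (X : A) (e : hom X X) :
  retract_splits e -> retract_splits (idm X - e) -> idempotent_splits e.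
Proof.
move=> [Y [i [p [pi ip]]]] [Z [j [q [qj jq]]]].
have pj : p \co j = 0.
  have -> : j = (idm X - e) \co j by rewrite -jq -mcompA qj mcompm1.
  by rewrite -ip mcompA mcompBr mcompm1 mcompA pi mcomp1m subrr mcomp0m.
have qi : q \co i = 0.
  have -> : q = q \co (idm X - e) by rewrite -jq mcompA qj mcomp1m.
  rewrite -ip -mcompA mcompBl mcomp1m -mcompA pi mcompm1 subrr; exact: mcompm0.
exists Y, Z, i, j, p, q; split; first by split=> //; rewrite ip jq addrC subrK.
  by rewrite -ip -mcompA pi mcompm1.
by rewrite -ip -mcompA pj mcompm0.
Qed.

Lemma retract_splits_zero (X Y : A) (i : hom Y X) (p : hom X Y) :
  p \co i = idm Y -> is_zero_object X -> is_zero_object Y.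
Proof. by move=> pi X0; rewrite /is_zero_object -pi -[i]mcomp1m X0 mcomp0m mcompm0. Qed.

(* In the intended model [S] is [X^(N)], [E] is [e] on every summand, [th] and
   [sh] shift the summands up and down, and [i0], [p0] belong to the first one. *)
Lemma swindle (X S : A) (e : hom X X) (E sh th : hom S S)
    (i0 : hom X S) (p0 : hom S X) :
  e \co e = e -> E \co E = E -> E \co sh = sh \co E -> E \co th = th \co E ->
  sh \co th = idm S -> th \co sh + i0 \co p0 = idm S -> p0 \co i0 = idm X ->
  E \co i0 = i0 \co e ->
  (forall f s : hom S S, f \co s = idm S -> retract_splits (idm S - s \co f)) ->
  retract_splits e.
Proof.
move=> ee EE Esh Eth shth thsh p0i0 Ei0 ker.
have cc := idempotent_compl EE.
have cE : E \co (idm S - E) = 0 by rewrite mcompBr mcompm1 EE subrr.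
have Ec : (idm S - E) \co E = 0 by rewrite mcompBl mcomp1m EE subrr.
have sum : idm S = E + (idm S - E) by rewrite addrC subrK.
move: (idm S - E) cc cE Ec sum => c cc cE Ec sum.
have [|K [i [p [pi ip]]]] := ker (sh \co E + c) (th \co E + c).
  rewrite mcompDl !mcompDr -!mcompA cE mcompm0 addr0 -Eth.
  rewrite [E \co (E \co th)]mcompA EE Eth mcompA shth mcomp1m.
  by rewrite -Eth mcompA Ec mcomp0m add0r cc -sum.
(* The complementary parts cancel in [idm S - s \co f], leaving [E] times the projection to the
   first summand. *)
have ip' : i \co p = i0 \co (e \co p0).
  have -> : i \co p = E \co (idm S - th \co sh).
    rewrite ip mcompDl !mcompDr -!mcompA cE mcompm0 addr0 -Esh.
    rewrite [E \co (E \co sh)]mcompA EE [c \co _]mcompA Ec mcomp0m.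
    rewrite add0r cc {1}sum opprD addrACA subrr addr0 mcompm1.
    by rewrite mcompmN !mcompA Eth.
  by rewrite -thsh [th \co sh + _]addrC addrK mcompA Ei0 mcompA.
(* [K] lies in the first summand of [S], so it can be moved to [X] along [p0] and [i0]. *)
have i_eq : i = i0 \co (e \co (p0 \co i)).
  by rewrite [e \co _]mcompA mcompA -ip' -mcompA pi mcompm1.
exists K, (p0 \co i), (p \co i0); split.
  rewrite {1}i_eq [p0 \co _]mcompA p0i0 mcomp1m -mcompA -i_eq; exact: pi.
rewrite -mcompA [i \co _]mcompA ip' -!mcompA p0i0 mcompm1 mcompA p0i0.
exact: mcomp1m.
Qed.

End Splitting.

Lemma idempotent_complete_retract (A : additive_category) :
  (forall (X : A) (e : hom X X), e \co e = e -> retract_splits e) ->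
  idempotent_complete A.
Proof.
move=> splits X e ee; apply: retract_splits_idempotent; first exact: splits.
by apply: splits; exact: idempotent_compl.
Qed.

(** * Countable copowers *)

Section Copowers.
Variable A : preadditive_category.

(** The universal property alone: projections and shifts are later obtained from it as maps out of
    [S]. *)
Definition is_copower (X S : A) (inc : nat -> hom X S) :=
  forall Y : A,
    (forall g : nat -> hom X Y, exists h : hom S Y, forall n, h \co inc n = g n) /\
    (forall h h' : hom S Y, (forall n, h \co inc n = h' \co inc n) -> h = h').

Definition has_copowers :=
  forall X : A, exists (S : A) (inc : nat -> hom X S), is_copower inc.

Lemma copower_zero (X S : A) (inc : nat -> hom X S) :
  is_copower inc -> is_zero_object X -> is_zero_object S.
Proof.
move=> cop X0; have [_ uniq] := cop S; apply: uniq => n.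
by rewrite -[inc n]mcompm1 X0 !mcompm0.
Qed.

Lemma copower_sig (X S Y : A) (inc : nat -> hom X S) : is_copower inc ->
  forall g : nat -> hom X Y, {h : hom S Y | forall n, h \co inc n = g n}.
Proof. by move=> cop g; apply: cid; have [+ _] := cop Y; apply. Qed.

Lemma has_copowers_sig : has_copowers -> forall X : A,
  {S : A & {inc : nat -> hom X S | is_copower inc}}.
Proof. by move=> cop X; have /cid[S /cid[inc ?]] := cop X; exists S, inc. Qed.

End Copowers.

(** Maps out of [S] are sequences of maps out of [P], and a countable product of short exact
    sequences of abelian groups is exact; preimages are chosen summand by summand. *)
Lemma rel_projective_copower (A : additive_category) (E : sequence_class A)
    (P S : A) (inc : nat -> hom P S) :
  is_copower inc -> rel_projective E P -> rel_projective E S.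
Proof.
move=> cop projP X Y Z f g Efg; have [injP kerP surP] := projP _ _ _ _ _ Efg.
split=> [h h' /= eq_h|h|h].
- have [_ uniq] := cop X; apply: uniq => n; apply: injP.
  by rewrite !mcompA eq_h.
- split=> [gh0|[h' <-]].
    have gh0n n : g \co (h \co inc n) = 0 by rewrite mcompA gh0 mcomp0m.
    have [c fc] := choice (fun n => (kerP _).1 (gh0n n)).
    have [x xc] := copower_sig cop c; exists x.
    by have [_ uniq] := cop Y; apply: uniq => n; rewrite -mcompA xc fc.
  have [_ uniq] := cop Z; apply: uniq => n; rewrite mcomp0m -!mcompA.
  by apply/kerP; exists (h' \co inc n).
have [c gc] := choice (fun n => surP (h \co inc n)).
have [x xc] := copower_sig cop c; exists x.
by have [_ uniq] := cop Z; apply: uniq => n; rewrite -mcompA xc gc.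
Qed.

(** * Idempotents in a stable category *)

Section Stable.
Variables (A : additive_category) (E : sequence_class A).
Hypothesis A_complete : idempotent_complete A.
Hypothesis A_copowers : has_copowers A.

Local Notation I := (projective_ideal E).
Local Notation "[ 'cl' f ]" := (qclass I f : hom (_ : stable_category E) _).

Lemma stable_compE (X Y Z : A) (g : hom Y Z) (f : hom X Y) :
  [cl g] \co [cl f] = [cl g \co f].
Proof. exact: qcompE. Qed.

Lemma stable_classD (X Y : A) (f g : hom X Y) : [cl f + g] = [cl f] + [cl g].
Proof. exact: qclassD. Qed.

Lemma stable_classB (X Y : A) (f g : hom X Y) : [cl f - g] = [cl f] - [cl g].
Proof. by apply/eqP; rewrite eq_sym subr_eq -stable_classD subrK. Qed.

Lemma stable_classP (X Y : A) (f g : hom X Y) :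
  [cl f] = [cl g] <-> factors_through_projective E (f - g).
Proof. exact: qclassP. Qed.

Lemma stable_class_repr (X Y : stable_category E) (f : hom X Y) :
  exists f0 : hom (X : A) (Y : A), f = [cl f0].
Proof. by exists (generic_quotient.repr f); rewrite qclass_repr. Qed.

Lemma stable_class0 (X P : A) (f : hom X P) : rel_projective E P -> [cl f] = 0.
Proof.
move=> projP; rewrite -[RHS](subrr [cl f]) -stable_classB subrr.
apply/stable_classP; rewrite subr0; exists P, f, (idm P); split=> //.
by rewrite mcomp1m.
Qed.

(* A section of [f] modulo a map factoring through a projective [P] becomes an
   honest section of [(f, -b) : X (+) P -> Y], whose kernel is taken in [A]. *)
Lemma stable_split_epi_kernel (X Y : stable_category E)
    (f : hom X Y) (s : hom Y X) :
  f \co s = idm Y -> retract_splits (idm X - s \co f).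
Proof.
have [f0 ->] := stable_class_repr f; have [s0 ->] := stable_class_repr s.
(* Both categories have the same objects; retyping [X] and [Y] in [A] lets biproducts be formed
   there. *)
move: X Y f0 s0 {f s} => X Y f s.
have -> : idm X = [cl idm (X : A)] by [].
have -> : idm Y = [cl idm (Y : A)] by [].
rewrite !stable_compE => /stable_classP[P [a [b [projP fs]]]].
have [T [j1 [j2 [q1 [q2 [q1j1 q2j2 q1j2 q2j1 idT]]]]]] :=
  @biproduct_exists A X P.
pose phi := f \co q1 - b \co q2; pose psi := j1 \co s + j2 \co a.
have phipsi : phi \co psi = idm (Y : A).
  rewrite mcompDr !mcompBl -!mcompA ![q1 \co (_ \co _)]mcompA.
  rewrite ![q2 \co (_ \co _)]mcompA q1j1 q2j2 q1j2 q2j1 !mcomp0m !mcomp1m.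
  by rewrite !mcompm0 subr0 sub0r -fs opprB addrC subrK.
have psiphi : (psi \co phi) \co (psi \co phi) = psi \co phi.
  by rewrite -mcompA [phi \co _]mcompA phipsi mcomp1m.
have [K [i [p [pi ip]]]] : retract_splits (idm T - psi \co phi).
  apply: idempotent_splits_retract; apply: A_complete.
  exact: idempotent_compl.
(* [q2] lands in the projective [P] and so vanishes stably: [T] and [X] become isomorphic, and the
   kernel [K] of [phi] transfers to [X]. *)
have cj1q1 : [cl j1] \co [cl q1] = [cl idm T].
  rewrite -idT stable_classD -!stable_compE (stable_class0 q2 projP) mcompm0.
  by rewrite addr0.
exists K, [cl q1 \co i], [cl p \co j1]; split.
  rewrite -!stable_compE -mcompA [[cl j1] \co _]mcompA cj1q1 !stable_compE.
  by rewrite mcomp1m pi.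
rewrite stable_compE -mcompA [i \co _]mcompA ip.
rewrite mcompBl mcompBr mcomp1m q1j1 -mcompA !stable_classB; congr (_ - _).
have -> : phi \co j1 = f.
  by rewrite mcompBl -!mcompA q1j1 q2j1 mcompm1 mcompm0 subr0.
by rewrite mcompA mcompDr !mcompA q1j1 q1j2 mcomp1m mcomp0m addr0.
Qed.

Lemma stable_idempotent_complete : idempotent_complete (stable_category E).
Proof.
apply: idempotent_complete_retract => X e'.
have [e ->] := stable_class_repr e'; move: X e {e'} => X e.
rewrite stable_compE => /stable_classP[P [a [b [projP ee]]]].
have [S [inc cop]] := has_copowers_sig A_copowers X.
have [Q [incQ copQ]] := has_copowers_sig A_copowers P.
have [_ extS] := cop S.
have [F Finc] := copower_sig cop (fun n => inc n \co e).
have [th thinc] := copower_sig cop (fun n => inc n.+1).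
(* [sh] kills the first summand, so [th \co sh] differs from the identity exactly by
   [inc 0 \co p0]. *)
have [sh shinc] := copower_sig cop (fun n => if n is m.+1 then inc m else 0).
have [p0 p0inc] := copower_sig cop (fun n => if n is _.+1 then 0 else idm (X : A)).
have [aa aainc] := copower_sig cop (fun n => incQ n \co a).
have [bb bbinc] := copower_sig copQ (fun n => inc n \co b).
apply: (@swindle _ _ _ _ [cl F] [cl sh] [cl th] [cl inc 0%N] [cl p0]).
- by rewrite stable_compE; apply/stable_classP; exists P, a, b.
(* [F] is idempotent only stably: its defect is [b \co a] on every summand, hence factors through
   the copower [Q] of [P]. *)
- rewrite stable_compE; apply/stable_classP; exists Q, aa, bb.
  split; first exact: rel_projective_copower copQ projP.
  apply: extS => n; rewrite mcompBl -!mcompA Finc aainc mcompA Finc.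
  by rewrite [bb \co _]mcompA bbinc -!mcompA -ee mcompBr.
- rewrite !stable_compE; congr (qclass _ _); apply: extS => -[|n].
    by rewrite -!mcompA Finc shinc mcompm0 mcompA shinc mcomp0m.
  by rewrite -!mcompA Finc shinc Finc mcompA shinc.
- rewrite !stable_compE; congr (qclass _ _); apply: extS => n.
  by rewrite -!mcompA Finc thinc Finc mcompA thinc.
- rewrite stable_compE; congr (qclass _ _); apply: extS => n.
  by rewrite -mcompA thinc shinc mcomp1m.
- rewrite !stable_compE -stable_classD; congr (qclass _ _); apply: extS => -[|n].
    by rewrite mcompDl -!mcompA shinc p0inc mcompm0 mcompm1 mcomp1m add0r.
  by rewrite mcompDl -!mcompA shinc p0inc thinc mcompm0 mcomp1m addr0.
- by rewrite stable_compE p0inc.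
- by rewrite !stable_compE Finc.
- by move=> f s; exact: stable_split_epi_kernel.
Qed.

End Stable.

(** * Passage from modules to bounded complexes *)

Section ComplexesTransfer.
Variable A : additive_category.

(** Splitting [e] in each degree suffices: since [e] commutes with the differential,
    [p \co diff X \co i] is a differential on the images, compatible with [i] and [p]. *)
Lemma cpx_retract_splits (X : cpx A) (e : hom X X) :
  idempotent_complete A -> e \co e = e -> retract_splits e.
Proof.
move=> compA ee.
have split_deg n : {Y : A & {i : hom Y (term X n) & {p : hom (term X n) Y |
    p \co i = idm Y /\ i \co p = degree e n}}}.
  have /compA/idempotent_splits_retract/cid[Y /cid[i /cid[p ?]]] :
    degree e n \co degree e n = degree e n by rewrite -[in RHS]ee.
  by exists Y, i, p.
pose Y n := projT1 (split_deg n).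
pose i n : hom (Y n) (term X n) := projT1 (projT2 (split_deg n)).
pose p n : hom (term X n) (Y n) := sval (projT2 (projT2 (split_deg n))).
have pi n : p n \co i n = idm (Y n).
  by have [] := svalP (projT2 (projT2 (split_deg n))).
have ip n : i n \co p n = degree e n.
  by have [] := svalP (projT2 (projT2 (split_deg n))).
clearbody Y i p; clear split_deg.
pose d n : hom (Y n) (Y (n + 1)) := p (n + 1) \co diff X n \co i n.
have di n : diff X n \co i n = i (n + 1) \co d n.
  rewrite /d 2!mcompA ip -degreeP -mcompA -ip -[i n \co _ \co _]mcompA pi.
  by rewrite mcompm1.
have pd n : d n \co p n = p (n + 1) \co diff X n.
  rewrite /d -mcompA ip -mcompA degreeP -ip.
  by rewrite -[i _ \co _ \co _]mcompA mcompA pi mcomp1m.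
have dK n : d (n + 1) \co d n = 0.
  by rewrite {1}/d -mcompA -di mcompA -[p _ \co _ \co _]mcompA diffK mcompm0 mcomp0m.
exists (Complex dK : cpx A), (ChainMap (X := Complex dK) (Y := X) di),
  (ChainMap (X := X) (Y := Complex dK) pd).
by split; apply: chain_map_ext => n; [exact: pi|exact: ip].
Qed.

(** Copowers are taken degreewise, with the differential induced by their universal property. The
    degreewise clause serves to carry bounds over from [X] to [S]. *)
Lemma cpx_has_copower (X : cpx A) : has_copowers A ->
  exists (S : cpx A) (inc : nat -> hom X S), is_copower inc /\
    forall n, is_copower (fun m => degree (inc m) n).
Proof.
move=> copA; pose cop n := has_copowers_sig copA (term X n).
pose S n := projT1 (cop n).
pose inc n : nat -> hom (term X n) (S n) := sval (projT2 (cop n)).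
have incP n : is_copower (inc n) by exact: svalP (projT2 (cop n)).
clearbody S inc; clear cop.
have dS n := copower_sig (incP n) (fun m => inc (n + 1) m \co diff X n).
pose d n := sval (dS n).
have dinc n m : d n \co inc n m = inc (n + 1) m \co diff X n.
  exact: (svalP (dS n)).
clearbody d; clear dS.
have dK n : d (n + 1) \co d n = 0.
  have [_ ext] := incP n (S (n + 1 + 1)); apply: ext => m.
  by rewrite -mcompA dinc mcompA dinc -mcompA diffK mcompm0 mcomp0m.
pose T : cpx A := Complex dK.
pose u m : hom X T := @ChainMap A X T (fun n => inc n m) (fun n => dinc n m).
exists T, u; split=> // Y; split=> [g|h h' eq_h].
  have hP n := copower_sig (incP n) (fun m => degree (g m) n).
  pose h n : hom (S n) (term Y n) := sval (hP n).
  have hinc n m : h n \co inc n m = degree (g m) n by exact: (svalP (hP n)).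
  have hd n : diff Y n \co h n = h (n + 1) \co d n.
    have [_ ext] := incP n (term Y (n + 1)); apply: ext => m.
    by rewrite -!mcompA hinc dinc mcompA hinc degreeP.
  exists (@ChainMap A T Y h hd) => m; apply: chain_map_ext => n; exact: hinc.
apply: chain_map_ext => n; have [_ ext] := incP n (term Y n); apply: ext => m.
exact: (congr1 (fun f : chain_map X Y => f n) (eq_h m)).
Qed.

Lemma satisfies_bound_sub b (X Y : cpx A) :
  (forall n, is_zero_object (term X n) -> is_zero_object (term Y n)) ->
  satisfies_bound b X -> satisfies_bound b Y.
Proof.
move=> XY; have up : bounded_above X -> bounded_above Y.
  by case=> N XN; exists N => n /XN; exact: XY.
have lo : bounded_below X -> bounded_below Y.
  by case=> N XN; exists N => n /XN; exact: XY.
by case: b => //= -[? ?]; split; auto.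
Qed.

Lemma bounded_cpx_idempotent_complete b :
  idempotent_complete A -> idempotent_complete (bounded_cpx A b).
Proof.
move=> compA; apply: idempotent_complete_retract => -[X bX] e ee.
have [Y [i [p [pi ip]]]] := @cpx_retract_splits X e compA ee.
have bY : satisfies_bound b Y.
  apply: (satisfies_bound_sub _ bX) => n; apply: retract_splits_zero.
  exact: (congr1 (fun f : chain_map Y Y => f n) pi).
by exists (FullObj bY), i, p.
Qed.

Lemma bounded_cpx_has_copowers b :
  has_copowers A -> has_copowers (bounded_cpx A b).
Proof.
move=> copA [X bX]; have [S [inc [incP incPn]]] := cpx_has_copower X copA.
have bS : satisfies_bound b S.
  by apply: (satisfies_bound_sub _ bX) => n; exact: copower_zero (incPn n).
by exists (FullObj bS), inc => -[Y bY]; exact: incP.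
Qed.

End ComplexesTransfer.

(** * Submodules, for images of idempotents and for direct sums *)

Section Submodule.
Variables (k : comPzRingType) (G : finGroupType) (M : kGmodule k G).
Variable P : pred M.
Hypothesis P_submod : submod_closed P.
Hypothesis P_act : forall g x, P x -> P (act g x).

Record submodule := Submodule { sub_val : M; sub_valP : P sub_val }.
HB.instance Definition _ := [isSub for sub_val].
HB.instance Definition _ := [Choice of submodule by <:].
HB.instance Definition _ :=
  GRing.SubChoice_isSubLmodule.Build k M P submodule P_submod.

Lemma sub_val_linear : linear sub_val.
Proof. exact: (linearP (val : submodule -> M)). Qed.

Definition sub_act g (x : submodule) : submodule :=
  Submodule (P_act g (sub_valP x)).

Definition sub_kG : kGmodule k G.
Proof.
refine (@KGmodule k G submodule sub_act _ _ _).
- move=> g a x y; apply: val_inj; rewrite [RHS]sub_val_linear /=.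
  by rewrite -act_linear -sub_val_linear.
- by move=> x; apply: val_inj; rewrite /= act1.
- by move=> g h x; apply: val_inj; rewrite /= actM.
Defined.

Definition sub_in : kGhom sub_kG M.
Proof. exact: (@KGhom k G sub_kG M sub_val sub_val_linear (fun _ _ => erefl)). Defined.

Definition sub_corestr (N : kGmodule k G) (f : kGhom N M) (fP : forall x, P (f x)) :
  kGhom N sub_kG.
Proof.
refine (@KGhom k G N sub_kG (fun x => Submodule (fP x)) _ _) => [a x y|g x].
  by apply: val_inj; rewrite [RHS]sub_val_linear /= linearP.
by apply: val_inj; rewrite /= kGfun_act.
Defined.

End Submodule.

(** * Idempotents and copowers of modules *)

Section ModuleConstructions.
Variables (k : comPzRingType) (G : finGroupType).

Lemma Mod_idempotent_complete : idempotent_complete (Mod k G).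
Proof.
apply: idempotent_complete_retract => M e ee.
have eeE x : e (e x) = e x by rewrite -[in RHS]ee.
(* The image of an idempotent is its set of fixed points, which is a boolean predicate. *)
pose P : pred (carrier M) := fun x => e x == x.
have P_submod : submod_closed P.
  split=> [|a x y]; rewrite !unfold_in /P ?linear0 // => /eqP ex /eqP ey.
  by rewrite kGfun_linear ex ey.
have P_act g x : P x -> P (act g x) by rewrite /P kGfun_act => /eqP ->.
have eP x : P (e x) by rewrite /P eeE.
exists (sub_kG P_submod P_act), (sub_in P_submod P_act),
  (sub_corestr P_submod P_act eP).
by split; apply: kGhom_ext => x //; apply: val_inj; exact: eqP (sub_valP x).
Qed.

Section Copower.
Variable M : kGmodule k G.

Definition seq_kG : kGmodule k G.
Proof.
refine (@KGmodule k G (nat -> M) (fun g f n => act g (f n)) _ _ _).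
- by move=> g a x y; apply/funext => n; exact: act_linear.
- by move=> x; apply/funext => n; exact: act1.
- by move=> g h x; apply/funext => n; exact: actM.
Defined.

Definition finitely_supported : pred seq_kG :=
  fun f => `[< exists N, forall n, (N <= n)%N -> f n = 0 >].

Lemma finitely_supported_submod : submod_closed finitely_supported.
Proof.
split=> [|a f g /asboolP[N fN] /asboolP[N' gN']]; apply/asboolP.
  by exists 0%N.
exists (maxn N N') => n; rewrite geq_max => /andP[/fN fn /gN' gn].
by rewrite /= addrfctE scalrfctE fn gn scaler0 addr0.
Qed.

Lemma finitely_supported_act g f :
  finitely_supported f -> finitely_supported (act g f).
Proof.
by move=> /asboolP[N fN]; apply/asboolP; exists N => n /fN /= ->; exact: act0.
Qed.

(** The direct sum of countably many copies of [M], realised inside their product. *)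
Definition fin_seq_kG := sub_kG finitely_supported_submod finitely_supported_act.

Definition seq_at (n : nat) : kGhom M seq_kG.
Proof.
refine (@KGhom k G M seq_kG (fun x m => if m == n then x else 0) _ _).
  move=> a x y; apply/funext => m; rewrite addrfctE scalrfctE /=.
  by case: eqP => // _; rewrite scaler0 addr0.
by move=> g x; apply/funext => m /=; case: eqP => // _; rewrite act0.
Defined.

Lemma seq_at_finitely_supported n x : finitely_supported (seq_at n x).
Proof.
by apply/asboolP; exists n.+1 => m /= /gtn_eqF ->.
Qed.

Definition fin_seq_at n : kGhom M fin_seq_kG :=
  sub_corestr finitely_supported_submod finitely_supported_act
    (seq_at_finitely_supported n).

Lemma fin_seq_bound (f : fin_seq_kG) :
  {N | forall n, (N <= n)%N -> sub_val f n = 0}.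
Proof. exact/cid/asboolP/(sub_valP f). Qed.

Lemma fin_seqE (f : fin_seq_kG) N : (forall n, (N <= n)%N -> sub_val f n = 0) ->
  f = \sum_(n < N) fin_seq_at n (sub_val f n).
Proof.
move=> fN; apply: val_inj.
rewrite (raddf_sum (sub_in finitely_supported_submod finitely_supported_act)).
apply/funext => m; rewrite fct_sumE /=.
have [mN|Nm] := ltnP m N; last first.
  by rewrite fN // big1 // => n _; case: eqP => // <-; exact: fN.
rewrite (bigD1 (Ordinal mN)) //= eqxx big1 ?addr0 // => n.
by rewrite -val_eqE eq_sym => /negPf ->.
Qed.

Section Lift.
Variables (Y : kGmodule k G) (g : nat -> kGhom M Y).

Definition fin_seq_lift_fun (f : fin_seq_kG) : Y :=
  \sum_(n < sval (fin_seq_bound f)) g n (sub_val f n).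

(** Terms beyond the support vanish, so the chosen bound is immaterial; this allows a common bound
    for several sequences when proving linearity. *)
Lemma fin_seq_liftE (f : fin_seq_kG) N :
  (forall n, (N <= n)%N -> sub_val f n = 0) ->
  fin_seq_lift_fun f = \sum_(n < N) g n (sub_val f n).
Proof.
rewrite /fin_seq_lift_fun; case: fin_seq_bound => N' /= fN' fN.
wlog le_NN : N N' fN fN' / (N <= N')%N => [sym|].
  by have [/sym|/ltnW/sym->] := leqP N N'; first exact.
rewrite (big_ord_widen _ (fun n => g n (sub_val f n)) le_NN) [RHS]big_mkcond /=.
by apply: eq_bigr => n _; case: ltnP => // /fN ->; rewrite linear0.
Qed.

Definition fin_seq_lift : kGhom fin_seq_kG Y.
Proof.
refine (@KGhom k G fin_seq_kG Y fin_seq_lift_fun _ _) => [a x y|h x].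
  have [N xN] := fin_seq_bound x; have [N' yN'] := fin_seq_bound y.
  have xM n : (maxn N N' <= n)%N -> sub_val x n = 0.
    by rewrite geq_max => /andP[/xN].
  have yM n : (maxn N N' <= n)%N -> sub_val y n = 0.
    by rewrite geq_max => /andP[_ /yN'].
  have xyE n : sub_val (a *: x + y) n = a *: sub_val x n + sub_val y n.
    by rewrite sub_val_linear.
  rewrite (fin_seq_liftE xM) (fin_seq_liftE yM) (@fin_seq_liftE _ (maxn N N')).
    by rewrite scaler_sumr -big_split; apply: eq_bigr => n _; rewrite xyE linearP.
  by move=> n nN; rewrite xyE xM ?yM // scaler0 addr0.
have [N xN] := fin_seq_bound x.
rewrite (fin_seq_liftE xN) (@fin_seq_liftE _ N) => [|n /xN /= ->]; last exact: act0.
rewrite (linear_sum_fun (f := @act _ _ Y h)); last exact: act_linear.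
by apply: eq_bigr => n _; rewrite -kGfun_act.
Defined.

Lemma fin_seq_lift_at n x : fin_seq_lift (fin_seq_at n x) = g n x.
Proof.
rewrite /= (@fin_seq_liftE _ n.+1) => [|m /= /gtn_eqF -> //].
rewrite big_ord_recr /= eqxx big1 ?add0r // => m _.
by rewrite ltn_eqF // linear0.
Qed.

End Lift.

Lemma Mod_copower : @is_copower (Mod k G) M fin_seq_kG fin_seq_at.
Proof.
move=> Y; split=> [g|h h' eq_h].
  by exists (fin_seq_lift g) => n; apply: kGhom_ext => x; exact: fin_seq_lift_at.
apply: kGhom_ext => f; have [N fN] := fin_seq_bound f.
rewrite (fin_seqE fN) !linear_sum; apply: eq_bigr => n _.
exact: (congr1 (fun u : kGhom M Y => u (sub_val f n)) (eq_h n)).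
Qed.

End Copower.

Lemma Mod_has_copowers : has_copowers (Mod k G).
Proof. by move=> M; exists (fin_seq_kG M), (@fin_seq_at M); exact: Mod_copower. Qed.

End ModuleConstructions.

Theorem proposition4p1 (k : comPzRingType) (G : finGroupType)
    (V : kGmodule k G) (V_free : free_of_finite_rank V) (b : bound) :
  [/\ idempotent_complete (Cpx k G b),
      idempotent_complete (K k G b),
      idempotent_complete (K_V_split b V),
      idempotent_complete (K_V_ts b V)
    & idempotent_complete (K_ts_V_split b V)].
Proof.
have complete : idempotent_complete (Cpx k G b).
  exact: bounded_cpx_idempotent_complete (@Mod_idempotent_complete k G).
have copowers : has_copowers (Cpx k G b).
  exact: bounded_cpx_has_copowers (@Mod_has_copowers k G).
(* One result covers all four quotients, as it holds for every class of sequences. *)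
by split=> //; exact: stable_idempotent_complete.
Qed.
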